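(* For every integer $n>2$, the number of pairs $(s,t)\in S_n\times S_n$ whose commutator $[s,t]=sts^{-1}t^{-1}$ is a $3$-cycle equals $$\#\mathcal{B}(n)=\frac{3}{8}\left(\sum_{k=1}^{n}\sigma_3(k)P(n-k)-2\sum_{k=1}^{n}k\,\sigma_1(k)P(n-k)+nP(n)\right)n!.$$
   Context: $\sigma_\ell(k)=\sum_{d\mid k}d^\ell$ is the sum of the $\ell$-th powers of the positive divisors of $k$. $P(m)$ is the number of partitions of $m$ (unordered sums of positive integers equal to $m$), with $P(0)=1$. Permutations compose as functions. *)

(* Defs.v *)
From mathcomp Require Import all_boot all_order all_fingroup all_algebra.
Set Implicit Arguments. Unset Strict Implicit. Unset Printing Implicit Defensive.

Definition sigma (l k : nat) : nat := \sum_(d <- divisors k) d ^ l.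

(* P(m): number of partitions of m.  A partition of m (an unordered sum of
   positive integers equal to m) is encoded by its multiplicity function:
   f i = number of parts equal to i.+1, for parts 1..m (no part exceeds m). *)
Definition npartitions (m : nat) : nat :=
  #|[set f : {ffun 'I_m -> 'I_m.+1} | \sum_(i < m) i.+1 * f i == m]|.

Definition is_3cycle (T : finType) (p : {perm T}) : bool :=
  [exists a : T, exists b : T, exists c : T,
    [&& a != b, b != c, a != c,
        (p a == b) && (p b == c) && (p c == a) &
        [forall x, [&& x != a, x != b & x != c] ==> (p x == x)]]].

(* Commutator [s,t] = s t s^-1 t^-1 with functional composition (apply t^-1
   first).  MathComp's product (s * t) x = t (s x), hence this spelling. *)
Definition commf (n : nat) (s t : 'S_n) : 'S_n := (t^-1 * s^-1 * t * s)%g.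

Lemma commfE n (s t : 'S_n) x : commf s t x = s (t (s^-1%g (t^-1%g x))).
Proof. by rewrite /commf !permM. Qed.

Definition Bset (n : nat) : {set 'S_n * 'S_n} :=
  [set st : 'S_n * 'S_n | is_3cycle (commf st.1 st.2)].

(* Main.v *)
Require Import Defs.
From mathcomp Require Import all_boot all_order all_fingroup all_algebra.
From mathcomp Require Import zify ring.
Set Implicit Arguments. Unset Strict Implicit. Unset Printing Implicit Defensive.

(* Since [s,t] t = s t s^-1, the pairs are counted by summing, over all t, the
   order of the centralizer of t times the number of 3-cycles c with c t
   conjugate to t; this is n! times the sum over cycle types of the latter number.

   Multiplying t by a 3-cycle (a b d) preserves the cycle type in two cases only:
   a, b, d lie on one cycle of t in a given cyclic order, or two of them lie on a
   cycle of length p, the third on a cycle of length q < p, and their distance on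
   the long cycle is prescribed so that the two lengths are exchanged.  If f_p is
   the number of p-cycles of t, the number of such 3-cycles is
   sum_p C(p,3) f_p + (n^2 - sum_p p^2 f_p^2) / 2.

   As P(n - jp) partitions of n have at least j parts equal to p, the sums over
   partitions become convolutions of P with divisor sums.  The term n^2 P(n) is
   eliminated using n P(n) = sum_k sigma_1(k) P(n-k) twice and the convolution
   12 sum_k sigma_1(k) sigma_1(m-k) = 5 sigma_3(m) + sigma_1(m) - 6 m sigma_1(m),
   proved by Liouville's method on the solutions of a x + b y = m. *)

Local Notation cyclen := fingraph.order.

(** * Convolution of divisor sums *)

Lemma sum_if_eq n k (F : nat -> nat) : 0 < k <= n ->
  \sum_(1 <= x < n.+1) (if x == k then F x else 0) = F k.
Proof.
move=> /andP[k0 kn]; rewrite -big_mkcond big_nat1_eq /=.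
by rewrite k0 ltnS kn.
Qed.

(** Divisors of [k] correspond to factorizations [k = a * x]. The box of summation does not depend
    on [k], so that a further sum over [k] can be exchanged with it. *)
Lemma sum_divisors n k (h : nat -> nat -> nat) : 0 < k <= n ->
  \sum_(d <- divisors k) h d (k %/ d)
  = \sum_(1 <= a < n.+1) \sum_(1 <= x < n.+1) (if a * x == k then h a x else 0).
Proof.
move=> /andP[k0 kn].
transitivity (\sum_(1 <= a < n.+1 | a %| k) h a (k %/ a)).
  rewrite -[RHS]big_filter; apply: perm_big; apply: uniq_perm.
  - exact: divisors_uniq.
  - by rewrite filter_uniq ?iota_uniq.
  move=> d; rewrite -dvdn_divisors // mem_filter mem_index_iota.
  case: (boolP (d %| k)) => //= dk; move: (dvdn_leq k0 dk) (dvdn_gt0 k0 dk); lia.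
rewrite big_mkcond; apply: eq_big_nat => a /andP[a0 an].
case: ifP => [/dvdnP[x kE]|ndk].
  rewrite -(@sum_if_eq n (k %/ a) (h a)); last first.
    by rewrite kE mulnK //; move: (leq_pmulr x a0); nia.
  apply: eq_bigr => y _; rewrite kE mulnK //.
  by rewrite (mulnC x) eqn_pmul2l.
rewrite big1 // => x _; case: eqP => // kE.
by move: ndk; rewrite -kE dvdn_mulr.
Qed.

Definition quads n : seq ((nat * nat) * (nat * nat)) :=
  let r := index_iota 1 n.+1 in
  [seq q <- [seq (u, v) | u <- [seq (a, b) | a <- r, b <- r],
                          v <- [seq (x, y) | x <- r, y <- r]]
  | q.1.1 * q.2.1 + q.1.2 * q.2.2 == n].

Lemma mem_pairs (S T : eqType) (s : seq S) (t : seq T) x y :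
  ((x, y) \in [seq (i, j) | i <- s, j <- t]) = (x \in s) && (y \in t).
Proof.
apply/allpairsP/andP => [[[i j] [/= is_ jt [-> ->]]] //|[xs yt]].
by exists (x, y).
Qed.

Lemma mem_quads n a b x y :
  ((a, b), (x, y)) \in quads n
  = [&& 0 < a, 0 < b, 0 < x, 0 < y & a * x + b * y == n].
Proof.
rewrite mem_filter /= !mem_pairs !mem_index_iota.
by case: eqP => [<-|_] /=; [nia | rewrite !andbF].
Qed.

Lemma quads_uniq n : uniq (quads n).
Proof.
have pu (s1 s2 : seq nat) : uniq s1 -> uniq s2 -> uniq [seq (a, b) | a <- s1, b <- s2].
  by move=> u1 u2; apply: allpairs_uniq => // -[? ?] [? ?].
rewrite filter_uniq //; apply: allpairs_uniq; rewrite ?pu ?iota_uniq //.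
by move=> [? ?] [? ?].
Qed.

Lemma sum_quads n (P : nat -> nat -> nat -> nat -> bool) (F : nat -> nat -> nat -> nat -> nat) :
  \sum_(q <- quads n | P q.1.1 q.1.2 q.2.1 q.2.2) F q.1.1 q.1.2 q.2.1 q.2.2
  = \sum_(1 <= a < n.+1) \sum_(1 <= b < n.+1) \sum_(1 <= x < n.+1)
     \sum_(1 <= y < n.+1)
     (if P a b x y && (a * x + b * y == n) then F a b x y else 0).
Proof.
rewrite big_filter_cond big_mkcond /= big_allpairs big_allpairs.
apply: eq_bigr => a _; apply: eq_bigr => b _; rewrite big_allpairs.
by apply: eq_bigr => x _; apply: eq_bigr => y _; rewrite andbC.
Qed.

(** The equation is invariant under exchanging [(a, x)] with [(b, y)]. *)
Lemma sum_quads_sym n (P : nat -> nat -> nat -> nat -> bool) (F : nat -> nat -> nat -> nat -> nat) :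
  \sum_(q <- quads n | P q.1.1 q.1.2 q.2.1 q.2.2) F q.1.1 q.1.2 q.2.1 q.2.2
  = \sum_(q <- quads n | P q.1.2 q.1.1 q.2.2 q.2.1) F q.1.2 q.1.1 q.2.2 q.2.1.
Proof.
pose sw (q : (nat * nat) * (nat * nat)) := ((q.1.2, q.1.1), (q.2.2, q.2.1)).
rewrite -[RHS](big_map sw (fun q => P q.1.1 q.1.2 q.2.1 q.2.2)
   (fun q => F q.1.1 q.1.2 q.2.1 q.2.2)).
apply: perm_big; apply: uniq_perm; first exact: quads_uniq.
  rewrite map_inj_uniq ?quads_uniq // => -[[a b] [x y]] [[a' b'] [x' y']].
  by case=> -> -> -> ->.
move=> [[a b] [x y]]; rewrite mem_quads; apply/idP/mapP.
  move=> h; exists ((b, a), (y, x)) => //; rewrite mem_quads; lia.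
by case=> -[[a' b'] [x' y']]; rewrite mem_quads => h [-> -> -> ->]; lia.
Qed.

(* The shear [a x + b y = a (x - y) + (a + b) y]. *)
Lemma sum_quads_shear n (F : nat -> nat -> nat -> nat -> nat) :
  \sum_(q <- quads n | q.2.2 < q.2.1) F q.1.1 (q.1.1 + q.1.2) (q.2.1 - q.2.2) q.2.2
  = \sum_(q <- quads n | q.1.1 < q.1.2) F q.1.1 q.1.2 q.2.1 q.2.2.
Proof.
pose sh (q : (nat * nat) * (nat * nat)) :=
  ((q.1.1, q.1.1 + q.1.2), (q.2.1 - q.2.2, q.2.2)).
rewrite -big_filter -[RHS]big_filter.
rewrite -(big_map sh predT (fun q => F q.1.1 q.1.2 q.2.1 q.2.2)).
apply: perm_big; apply: uniq_perm.
- rewrite map_inj_in_uniq ?(filter_uniq _ (quads_uniq n)) // => -[[a b] [x y]] [[a' b'] [x' y']].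
  rewrite !mem_filter /= => /andP[xy _] /andP[xy' _] [? ? ? ?].
  by congr ((_, _), (_, _)); lia.
- exact: filter_uniq (quads_uniq n).
move=> [[a b] [x y]]; rewrite mem_filter mem_quads /=; apply/mapP/idP.
  case=> -[[a' b'] [x' y']]; rewrite mem_filter mem_quads /=.
  move=> h [-> -> -> ->]; nia.
move=> h; exists ((a, b - a), (x + y, y)); first by rewrite mem_filter mem_quads /=; nia.
by rewrite /sh /=; congr ((_, _), (_, _)); lia.
Qed.

Lemma sum_quads_split n (u v : (nat * nat) * (nat * nat) -> nat)
    (F : (nat * nat) * (nat * nat) -> nat) :
  \sum_(q <- quads n) F q = \sum_(q <- quads n | u q < v q) F q
    + \sum_(q <- quads n | v q < u q) F q + \sum_(q <- quads n | u q == v q) F q.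
Proof.
rewrite !(big_mkcond (fun q => _ < _)) (big_mkcond (fun q => _ == _)) /= -!big_split.
by apply: eq_bigr => q _ /=; case: ltngtP; rewrite ?addn0.
Qed.

(** Write [4ab = (a + b)^2 - (a - b)^2]; split the sum of the first square by the order of [x, y],
    that of the second by the order of [a, b]. Shear and symmetry turn the off-diagonal parts into
    sums of [a^2], which cancel up to the diagonals [a = b] and [x = y]. *)
Lemma liouville_square n :
  4 * \sum_(q <- quads n) q.1.1 * q.1.2
  + 2 * \sum_(q <- quads n | q.1.1 == q.1.2) q.1.1 ^ 2
  = 2 * \sum_(q <- quads n | q.2.1 == q.2.2) q.1.1 ^ 2
  + \sum_(q <- quads n | q.2.1 == q.2.2) (q.1.1 + q.1.2) ^ 2.
Proof.
(* One of the two truncated differences vanishes, so their sum is [|a - b|]. *)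
have Esq : \sum_(q <- quads n) (q.1.1 + q.1.2) ^ 2
  = 4 * (\sum_(q <- quads n) q.1.1 * q.1.2)
    + \sum_(q <- quads n) ((q.1.1 - q.1.2) + (q.1.2 - q.1.1)) ^ 2.
  rewrite big_distrr -big_split /=; apply: eq_bigr => q _.
  by case: (leqP q.1.1 q.1.2) => /subnK; nia.
have Esum := sum_quads_split n (fun q => q.2.1) (fun q => q.2.2)
  (fun q => (q.1.1 + q.1.2) ^ 2).
have Edif := sum_quads_split n (fun q => q.1.1) (fun q => q.1.2)
  (fun q => ((q.1.1 - q.1.2) + (q.1.2 - q.1.1)) ^ 2).
have Eab := sum_quads_split n (fun q => q.1.1) (fun q => q.1.2) (fun q => q.1.1 ^ 2).
have Exy := sum_quads_split n (fun q => q.2.1) (fun q => q.2.2) (fun q => q.1.1 ^ 2).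
(* The shear carries the sums of [(a + b)^2], [a^2] and [b^2] over [y < x] to those of [b^2], [a^2]
   and [(b - a)^2] over [a < b]. *)
have S1 := sum_quads_shear n (fun a b x y => b ^ 2).
have S2 := sum_quads_shear n (fun a b x y => a ^ 2).
have S3 := sum_quads_shear n (fun a b x y => (b - a) ^ 2).
have Y1 := sum_quads_sym n (fun a b x y => x < y) (fun a b x y => (a + b) ^ 2).
have Y2 := sum_quads_sym n (fun a b x y => a < b) (fun a b x y => b ^ 2).
have Y3 := sum_quads_sym n (fun a b x y => x < y) (fun a b x y => a ^ 2).
have Y4 := sum_quads_sym n (fun a b x y => a < b)
   (fun a b x y => ((a - b) + (b - a)) ^ 2).
rewrite /= in Esum Edif Eab Exy S1 S2 S3 Y1 Y2 Y3 Y4.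
have Z1 : \sum_(q <- quads n | q.2.2 < q.2.1) (q.1.2 + q.1.1) ^ 2
  = \sum_(q <- quads n | q.2.2 < q.2.1) (q.1.1 + q.1.2) ^ 2.
  by apply: eq_bigr => q _; rewrite addnC.
have Z2 : \sum_(q <- quads n | q.2.2 < q.2.1) (q.1.1 + q.1.2 - q.1.1) ^ 2
  = \sum_(q <- quads n | q.2.2 < q.2.1) q.1.2 ^ 2.
  by apply: eq_bigr => q _; rewrite addKn.
have Z3 : \sum_(q <- quads n | q.1.1 < q.1.2) ((q.1.1 - q.1.2) + (q.1.2 - q.1.1)) ^ 2
  = \sum_(q <- quads n | q.1.1 < q.1.2) (q.1.2 - q.1.1) ^ 2.
  by apply: eq_bigr => q ab; congr (_ ^ 2); lia.
have Z4 : \sum_(q <- quads n | q.1.2 < q.1.1) ((q.1.1 - q.1.2) + (q.1.2 - q.1.1)) ^ 2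
  = \sum_(q <- quads n | q.1.2 < q.1.1) ((q.1.2 - q.1.1) + (q.1.1 - q.1.2)) ^ 2.
  by apply: eq_bigr => q _; rewrite addnC.
have Z5 : \sum_(q <- quads n | q.1.1 == q.1.2) ((q.1.1 - q.1.2) + (q.1.2 - q.1.1)) ^ 2 = 0.
  by rewrite big1 // => q /eqP ->; rewrite subnn.
lia.
Qed.

Lemma sum_sum_pairs n z (H : nat -> nat) : z <= n ->
  \sum_(1 <= x < n.+1) \sum_(1 <= y < n.+1) (if x + y == z then H x else 0)
  = \sum_(1 <= x < z) H x.
Proof.
move=> zn; rewrite [RHS](big_nat_widen _ _ n.+1) ?(leqW zn) // [RHS]big_mkcond.
apply: eq_big_nat => x /andP[x0 xn]; case: ltnP => xz.
  rewrite -[RHS](@sum_if_eq n (z - x) (fun=> H x)); last lia.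
  by apply: eq_bigr => y _; congr (if _ then _ else _); lia.
by apply: big1_seq => y; rewrite mem_index_iota; case: ifP => //; lia.
Qed.

(** Pairs are grouped by their sum [z], and [y = z - x] is then determined. The sums range up to
    [2n]; the hypothesis discards those beyond [n]. *)
Lemma sum_pairs_group n (G : nat -> nat -> nat) :
  (forall x z, n < z -> G x z = 0) ->
  \sum_(1 <= x < n.+1) \sum_(1 <= y < n.+1) G x (x + y)
  = \sum_(1 <= z < n.+1) \sum_(1 <= x < z) G x z.
Proof.
move=> G0.
transitivity (\sum_(1 <= z < n.+1) \sum_(1 <= x < n.+1)
    \sum_(1 <= y < n.+1) (if x + y == z then G x z else 0)); last first.
  by apply: eq_big_nat => z /andP[_ zn]; rewrite (@sum_sum_pairs n z (G^~ z)).
rewrite [RHS]exchange_big; apply: eq_big_nat => x /andP[x0 xn].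
rewrite [RHS]exchange_big; apply: eq_big_nat => y /andP[y0 yn].
have [xyn|nxy] := leqP (x + y) n.
  rewrite -[LHS](@sum_if_eq n (x + y) (G x)); last lia.
  by apply: eq_bigr => z _; rewrite eq_sym.
rewrite G0 // big1_seq // => z; rewrite mem_index_iota.
by case: eqP => //; lia.
Qed.

(** For [a = b] the equation reads [a (x + y) = n], and [n / a] is a sum of two positive integers in
    [n / a - 1] ways. *)
Lemma sum_quads_diag_l n (F : nat -> nat) : 0 < n ->
  \sum_(q <- quads n | q.1.1 == q.1.2) F q.1.1
  = \sum_(d <- divisors n) F d * (n %/ d).-1.
Proof.
move=> n0; rewrite (sum_quads n (fun a b x y => a == b) (fun a b x y => F a)).
rewrite (@sum_divisors n n (fun a z => F a * z.-1)) ?n0 ?leqnn //.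
apply: eq_big_nat => a /andP[a0 an].
rewrite (eq_bigr (fun b => if b == a then \sum_(1 <= x < n.+1)
   \sum_(1 <= y < n.+1) (if a * (x + y) == n then F a else 0) else 0)); last first.
  move=> b _; rewrite eq_sym; case: eqP => [->|_] /=; last by rewrite big1 // => x _; rewrite big1.
  by apply: eq_bigr => x _; apply: eq_bigr => y _; rewrite mulnDr.
rewrite (@sum_if_eq n a (fun=> _)); last by rewrite a0.
rewrite (@sum_pairs_group n (fun x z => if a * z == n then F a else 0)); last first.
  by move=> x z nz; case: eqP => //; nia.
by apply: eq_bigr => z _; rewrite sum_nat_const_nat subn1 mulnC; case: eqP.
Qed.

(** For [x = y] the equation reads [(a + b) x = n]: the divisor is [d = a + b], and [a] is free
    below [d]. *)
Lemma sum_quads_diag_r n (H : nat -> nat -> nat) : 0 < n ->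
  \sum_(q <- quads n | q.2.1 == q.2.2) H q.1.1 (q.1.1 + q.1.2)
  = \sum_(d <- divisors n) \sum_(1 <= a < d) H a d.
Proof.
move=> n0.
rewrite (sum_quads n (fun a b x y => x == y) (fun a b x y => H a (a + b))).
rewrite (@sum_divisors n n (fun d _ => \sum_(1 <= a < d) H a d)) ?n0 ?leqnn //.
transitivity (\sum_(1 <= a < n.+1) \sum_(1 <= b < n.+1)
    \sum_(1 <= x < n.+1) (if (a + b) * x == n then H a (a + b) else 0)).
  apply: eq_bigr => a _; apply: eq_bigr => b _.
  apply: eq_big_nat => x /andP[x0 xn].
  rewrite -[RHS](@sum_if_eq n x (fun y => if (a + b) * x == n then H a (a + b) else 0)); last lia.
  apply: eq_bigr => y _; rewrite eq_sym; case: eqP => [->|] //=.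
  by rewrite mulnDl.
rewrite (@sum_pairs_group n
  (fun a z => \sum_(1 <= x < n.+1) (if z * x == n then H a z else 0))); last first.
  move=> x z nz; rewrite big1_seq // => y; rewrite mem_index_iota.
  by case: eqP => //; nia.
apply: eq_bigr => z _; rewrite exchange_big; apply: eq_bigr => x _.
by case: eqP => // _; rewrite big1.
Qed.

Lemma sum_squares d : 6 * (\sum_(1 <= a < d) a ^ 2) + 3 * d ^ 2 = 2 * d ^ 3 + d.
Proof.
elim: d => [|[|d] IHd]; [by rewrite big_geq | by rewrite big_geq |].
by rewrite big_nat_recr //=; nia.
Qed.

(** Cutting [n] at [k = a x] identifies the convolution with the sum of [a b] over [quads n]. In
    [liouville_square] the diagonals evaluate to divisor sums, and the terms in [sigma 2 n]
    cancel. *)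
Lemma sigma_convolution n : 0 < n ->
  12 * (\sum_(1 <= k < n) sigma 1 k * sigma 1 (n - k)) + 6 * (n * sigma 1 n)
  = 5 * sigma 3 n + sigma 1 n.
Proof.
move=> n0.
have ES : \sum_(q <- quads n) q.1.1 * q.1.2
    = \sum_(1 <= k < n) sigma 1 k * sigma 1 (n - k).
  rewrite (sum_quads n (fun a b x y => true) (fun a b x y => a * b)).
  have sE k : 0 < k <= n -> sigma 1 k
    = \sum_(1 <= a < n.+1) \sum_(1 <= x < n.+1) (if a * x == k then a else 0).
    by move=> kn; rewrite -(@sum_divisors n k (fun a _ => a)).
  transitivity (\sum_(1 <= k < n) \sum_(1 <= a < n.+1) \sum_(1 <= b < n.+1)
      \sum_(1 <= x < n.+1) \sum_(1 <= y < n.+1)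
      (if (a * x == k) && (b * y == n - k) then a * b else 0)); last first.
    apply: eq_big_nat => k kn; rewrite !sE; try lia.
    rewrite big_distrl; apply: eq_bigr => a _.
    rewrite big_distrr; apply: eq_bigr => b _ /=.
    rewrite big_distrl; apply: eq_bigr => x _ /=.
    rewrite big_distrr; apply: eq_bigr => y _ /=.
    by do 2?case: eqP; rewrite ?muln0.
  rewrite [RHS]exchange_big; apply: eq_big_nat => a /andP[a0 _].
  rewrite [RHS]exchange_big; apply: eq_big_nat => b /andP[b0 _].
  rewrite [RHS]exchange_big; apply: eq_big_nat => x /andP[x0 _].
  rewrite [RHS]exchange_big; apply: eq_big_nat => y /andP[y0 _] /=.
  case: eqP => [E|nE].
    (* Only [k = a * x] contributes; it is below [n] because [b * y] is positive. *)
    rewrite (eq_big_nat _ _ (F2 := fun k => if k == a * x then a * b else 0)).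
      rewrite -{1}(prednK n0) (@sum_if_eq n.-1 (a * x) (fun=> a * b)) //; nia.
    by move=> k kn; rewrite (eq_sym k); case: eqP => //= ak; case: eqP => //; lia.
  rewrite big1_seq // => k; rewrite mem_index_iota => kn.
  by case: eqP => //= ak; case: eqP => //; lia.
have D1 := sum_quads_diag_l (fun a => a ^ 2) n0.
have D2 := sum_quads_diag_r (fun a z => a ^ 2) n0.
have D3 := sum_quads_diag_r (fun a z => z ^ 2) n0.
have L := liouville_square n; rewrite /= in D1 D2 D3 L.
have E1 : \sum_(d <- divisors n) d ^ 2 * (n %/ d).-1 + sigma 2 n = n * sigma 1 n.
  rewrite /sigma big_distrr -big_split /=; apply: eq_big_seq => d.
  rewrite -dvdn_divisors // => /dvdnP[[|z] nE]; first lia.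
  have d0 : 0 < d by lia.
  by rewrite nE mulnK //=; nia.
have E2 : 6 * (\sum_(d <- divisors n) \sum_(1 <= a < d) a ^ 2) + 3 * sigma 2 n
    = 2 * sigma 3 n + sigma 1 n.
  rewrite /sigma !big_distrr -!big_split /=; apply: eq_bigr => d _.
  by rewrite sum_squares expn1.
have E3 : \sum_(d <- divisors n) \sum_(1 <= a < d) d ^ 2 + sigma 2 n = sigma 3 n.
  rewrite /sigma -big_split /=; apply: eq_big_seq => d.
  rewrite -dvdn_divisors // => dn; move: (dvdn_gt0 n0 dn) => d0.
  by rewrite sum_nat_const_nat; nia.
lia.
Qed.

(** * Partitions *)

(** The bound [N] on parts and multiplicities is separated from [m], so that partitions of different
    integers live in one type. *)
Definition partitions_in (N m : nat) : {set {ffun 'I_N -> 'I_N.+1}} :=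
  [set f : {ffun 'I_N -> 'I_N.+1} | \sum_(i < N) i.+1 * f i == m].

Lemma partitions_in_le N m (f : {ffun 'I_N -> 'I_N.+1}) (i : 'I_N) :
  f \in partitions_in N m -> i.+1 * f i <= m.
Proof. by rewrite inE => /eqP <-; rewrite (bigD1 i) //= leq_addr. Qed.

Lemma card_partitions_in N m : m <= N -> #|partitions_in N m| = npartitions m.
Proof.
(* Extension by multiplicity 0 for the parts larger than [m]. *)
move=> mN; pose gn (g : {ffun 'I_m -> 'I_m.+1}) (k : nat) :=
  if insub k is Some j then g j : nat else 0.
have gnE g (i : 'I_m) : gn g i = g i by rewrite /gn valK.
have gn_le g k : gn g k <= N.
  by rewrite /gn; case: insub => //= j; have := ltn_ord (g j); lia.
have gn0 g k : m <= k -> gn g k = 0 by move=> mk; rewrite /gn insubF // ltnNge mk.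
pose ext g := [ffun i : 'I_N => inord (gn g i) : 'I_N.+1].
have extE g i : ext g i = gn g i :> nat by rewrite ffunE inordK // ltnS.
have ext_inj : injective ext.
  move=> g g' /ffunP eg; apply/ffunP => i; apply: val_inj => /=.
  by rewrite -!gnE -(extE g (widen_ord mN i)) eg extE.
have sumE g : \sum_(i < N) i.+1 * ext g i = \sum_(i < m) i.+1 * g i.
  rewrite [RHS](eq_bigr (fun i : 'I_m => i.+1 * gn g i)); last by move=> i _; rewrite gnE.
  rewrite (big_ord_widen N (fun k => k.+1 * gn g k)) // [RHS]big_mkcond.
  by apply: eq_bigr => i _; rewrite extE; case: ltnP => // /gn0 ->; rewrite muln0.
rewrite /npartitions -(card_imset _ ext_inj); apply: eq_card => f.
apply/idP/imsetP => [fP|[g gP ->]]; last by move: gP; rewrite !inE sumE.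
have fle (i : 'I_N) : i.+1 * f i <= m := partitions_in_le i fP.
pose g := [ffun i : 'I_m => inord (f (widen_ord mN i)) : 'I_m.+1].
have gE : f = ext g.
  apply/ffunP => i; apply: val_inj => /=; rewrite extE /gn.
  case: insubP => [j ji jiE|]; last by rewrite -leqNgt => mi; have := fle i; case: (f i : nat) => [|k]; [|nia].
  rewrite ffunE inordK; last by have := fle (widen_ord mN j); nia.
  by congr (f _ : nat); apply: val_inj; rewrite /= jiE.
by exists g => //; move: fP; rewrite !inE gE sumE.
Qed.

(** Adding [j] parts equal to [i.+1] is a bijection from the partitions of [n - i.+1 * j]. *)
Lemma card_partitions_ge n (i : 'I_n) j :
  #|[set f in partitions_in n n | j <= f i]|
  = if i.+1 * j <= n then npartitions (n - i.+1 * j) else 0.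
Proof.
case: leqP => [jn|nj]; last first.
  apply/eqP; rewrite cards_eq0; apply/eqP/setP => f; rewrite in_set0 in_set.
  by apply/negP => /andP[/(partitions_in_le i) fP jf]; move: fP jf; move: (nat_of_ord (f i)) => k; nia.
rewrite -(@card_partitions_in n) ?leq_subr //.
pose add (g : {ffun 'I_n -> 'I_n.+1}) :=
  [ffun k => inord (g k + j * (k == i)) : 'I_n.+1].
(* On partitions the new multiplicity stays within [n], so [inord] does not fall back to its
   default. *)
have addE g k : g \in partitions_in n (n - i.+1 * j) ->
    add g k = g k + j * (k == i) :> nat.
  move=> gP; rewrite ffunE inordK //; have := partitions_in_le k gP.
  by case: eqP => [->|_]; nia.
have sum_add g : g \in partitions_in n (n - i.+1 * j) ->
    \sum_(k < n) k.+1 * add g k = n.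
  move=> gP; rewrite (eq_bigr (fun k : 'I_n => k.+1 * g k + k.+1 * (j * (k == i)))).
    rewrite big_split /= [X in _ + X](bigD1 i) //= [X in _ + (_ + X)]big1 => [|k /negPf ->].
      by move: gP; rewrite inE eqxx addn0 muln1 => /eqP ->; rewrite subnK.
    by rewrite !muln0.
  by move=> k _; rewrite addE // mulnDr.
rewrite -[RHS](card_in_imset (f := add)) => [|g g' gP g'P /ffunP eg].
  apply: eq_card => f; apply/idP/imsetP => [|[g gP ->]].
    rewrite !inE => /andP[/eqP fn jf].
    pose g := [ffun k => inord (f k - j * (k == i)) : 'I_n.+1].
    have gE k : g k = f k - j * (k == i) :> nat.
      by rewrite ffunE inordK //; have := ltn_ord (f k); lia.
    have gP : g \in partitions_in n (n - i.+1 * j).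
      rewrite inE; apply/eqP; move: fn.
      rewrite (bigD1 i) //= => fn; rewrite (bigD1 i) //= gE eqxx muln1 mulnBr.
      rewrite (eq_bigr (fun k : 'I_n => k.+1 * f k)).
        by rewrite -[X in _ = X - _]fn addnBAC // leq_mul.
      by move=> k /negPf ki; rewrite gE ki muln0 subn0.
    exists g => //; apply/ffunP => k; apply: val_inj; rewrite /= addE // gE.
    by case: eqP => [->|_]; rewrite ?muln1 ?muln0 ?subn0 ?addn0 ?subnK.
  by rewrite !inE sum_add // eqxx addE // eqxx muln1 leq_addl.
apply/ffunP => k; apply: val_inj; have := congr1 val (eg k).
by rewrite /= !addE //; apply: addIn.
Qed.

(** Double counting: [h p j] is counted once for each partition with at least [j] parts equal to
    [p], that is [npartitions (n - p * j)] times. Collecting by [k = p * j] gives the divisor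
    sums. *)
Lemma sum_partitions n (h : nat -> nat -> nat) :
  \sum_(f in partitions_in n n) \sum_(i < n) \sum_(1 <= j < (f i).+1) h i.+1 j
  = \sum_(1 <= k < n.+1) (\sum_(d <- divisors k) h d (k %/ d)) * npartitions (n - k).
Proof.
transitivity (\sum_(1 <= p < n.+1) \sum_(1 <= j < n.+1)
    (if p * j <= n then h p j * npartitions (n - p * j) else 0)).
  rewrite exchange_big big_add1 /= big_mkord; apply: eq_bigr => i _.
  transitivity (\sum_(f in partitions_in n n) \sum_(1 <= j < n.+1)
     (if j <= f i then h i.+1 j else 0)).
    apply: eq_bigr => f _; rewrite -big_mkcond /=.
    by rewrite (big_nat_widen _ _ n.+1) ?ltn_ord //; apply: eq_bigl => j; rewrite ltnS.
  rewrite exchange_big; apply: eq_bigr => j _.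
  rewrite -big_mkcondr /= sum_nat_cond_const.
  have -> : #|[set f in partitions_in n n | j <= f i]|
    = if i.+1 * j <= n then npartitions (n - i.+1 * j) else 0.
    exact: card_partitions_ge.
  by case: ifP => _; rewrite ?muln0 // mulnC.
transitivity (\sum_(1 <= k < n.+1) \sum_(1 <= p < n.+1) \sum_(1 <= j < n.+1)
   (if p * j == k then h p j * npartitions (n - k) else 0)); last first.
  apply: eq_big_nat => k kn; rewrite (@sum_divisors n k h) //.
  rewrite big_distrl; apply: eq_bigr => p _ /=.
  by rewrite big_distrl; apply: eq_bigr => j _ /=; case: eqP.
rewrite [RHS]exchange_big; apply: eq_big_nat => p /andP[p0 pn].
rewrite [RHS]exchange_big; apply: eq_big_nat => j /andP[j0 jn] /=.
case: leqP => pj.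
  rewrite -[LHS](@sum_if_eq n (p * j) (fun k => h p j * npartitions (n - k))); last nia.
  by apply: eq_bigr => k _; rewrite eq_sym.
by rewrite big1_seq // => k; rewrite mem_index_iota; case: eqP => //; nia.
Qed.

(** Weighting every part by its size gives total weight [n] to each partition. *)
Lemma npartitions_rec n :
  \sum_(1 <= k < n.+1) sigma 1 k * npartitions (n - k) = n * npartitions n.
Proof.
have := sum_partitions n (fun d _ => d).
rewrite (eq_bigr (fun=> n)) => [|f].
  rewrite sum_nat_const card_partitions_in // mulnC => ->.
  by apply: eq_bigr => k _.
rewrite inE => /eqP fn; rewrite -[RHS]fn; apply: eq_bigr => i _.
by rewrite sum_nat_const_nat subn1 mulnC.
Qed.

(** One factor [n] is absorbed by [npartitions_rec] and the other is written [k + (n - k)]. Applying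
    the recursion again to [n - k] produces the convolution of [sigma 1] with itself. *)
Lemma npartitions_rec2 n :
  12 * (n ^ 2 * npartitions n)
  = 5 * (\sum_(1 <= k < n.+1) sigma 3 k * npartitions (n - k))
  + 6 * (\sum_(1 <= k < n.+1) k * sigma 1 k * npartitions (n - k))
  + n * npartitions n.
Proof.
have E1 : n ^ 2 * npartitions n
    = \sum_(1 <= k < n.+1) k * sigma 1 k * npartitions (n - k)
    + \sum_(1 <= k < n.+1) sigma 1 k * ((n - k) * npartitions (n - k)).
  rewrite -mulnA -npartitions_rec big_distrr -big_split /=.
  by apply: eq_big_nat => k kn; rewrite -{1}(@subnK k n); nia.
have E2 : \sum_(1 <= k < n.+1) sigma 1 k * ((n - k) * npartitions (n - k))
   = \sum_(1 <= m < n.+1) (\sum_(1 <= k < m) sigma 1 k * sigma 1 (m - k)) * npartitions (n - m).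
  transitivity (\sum_(1 <= k < n.+1) \sum_(1 <= l < n.+1)
     (if k + l <= n then sigma 1 k * sigma 1 l * npartitions (n - (k + l)) else 0)).
    apply: eq_big_nat => k kn; rewrite -npartitions_rec big_distrr /=.
    rewrite (big_nat_widen _ _ n.+1); last lia.
    rewrite big_mkcond; apply: eq_big_nat => l ln /=.
    have -> : (l < (n - k).+1) = (k + l <= n) by lia.
    by case: ifP => // _; rewrite mulnA subnDA.
  (* The cutoff is the vanishing required by [sum_pairs_group]. *)
  pose G x z := if z <= n then sigma 1 x * sigma 1 (z - x) * npartitions (n - z) else 0.
  rewrite (eq_bigr (fun k => \sum_(1 <= l < n.+1) G k (k + l))); last first.
    by move=> k _; apply: eq_bigr => l _; rewrite /G addKn.
  rewrite sum_pairs_group => [|x z nz]; last by rewrite /G; case: leqP => //; lia.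
  apply: eq_big_nat => m mn; rewrite big_distrl /=; apply: eq_bigr => k _.
  by rewrite /G; case: leqP => //; lia.
have E3 : 12 * \sum_(1 <= m < n.+1)
      (\sum_(1 <= k < m) sigma 1 k * sigma 1 (m - k)) * npartitions (n - m)
    + 6 * (\sum_(1 <= k < n.+1) k * sigma 1 k * npartitions (n - k))
    = 5 * (\sum_(1 <= k < n.+1) sigma 3 k * npartitions (n - k))
    + \sum_(1 <= k < n.+1) sigma 1 k * npartitions (n - k).
  rewrite !big_distrr -!big_split /=; apply: eq_big_nat => k /andP[k0 _].
  by rewrite !mulnA -!mulnDl -sigma_convolution // mulnA.
by rewrite npartitions_rec in E3; lia.
Qed.

(** * Cycle types and conjugacy *)

Section CycleSums.
Variable T : finType.
Implicit Types (t u v : {perm T}) (g : nat -> nat).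

Lemma sum_cyclen_flatten t (ss : seq (seq T)) g :
  (forall s, s \in ss -> fcycle t s) -> uniq (flatten ss) ->
  \sum_(x <- flatten ss) g (cyclen t x) = \sum_(s <- ss) size s * g (size s).
Proof.
elim: ss => [|s ss IHss] cyc; first by rewrite !big_nil.
rewrite /= cat_uniq big_cat big_cons => /and3P[us _ uss] /=; congr (_ + _).
  rewrite (eq_big_seq (fun=> g (size s))) => [|x xs].
    by rewrite big_const_seq count_predT iter_addn_0 mulnC.
  by rewrite (order_cycle (cyc s _)) ?mem_head.
by apply: IHss => // s' s'ss; apply: cyc; rewrite inE s'ss orbT.
Qed.

Lemma fcycle_flatten_closed t (ss : seq (seq T)) x y :
  (forall s, s \in ss -> fcycle t s) -> fconnect t x y ->
  (x \in flatten ss) = (y \in flatten ss).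
Proof.
move=> cyc; suff H z w : fconnect t z w -> z \in flatten ss -> w \in flatten ss.
  by move=> xy; apply/idP/idP; apply: H; rewrite // (fconnect_sym perm_inj).
move=> zw /flattenP[s sss zs]; apply/flattenP; exists s => //.
by rewrite -(fconnect_cycle (cyc s sss) zs).
Qed.

(** The complement of a union of cycles of [t] is stable under [t], so the orbit of [x] never
    reaches a point where [u] may differ. *)
Lemma cyclen_outside t u (ss : seq (seq T)) x :
  (forall s, s \in ss -> fcycle t s) ->
  (forall y, y \notin flatten ss -> u y = t y) ->
  x \notin flatten ss -> cyclen u x = cyclen t x.
Proof.
move=> cyc tu xss.
have itE i : iter i u x = iter i t x.
  elim: i => //= i ->; apply: tu.
  by rewrite -(fcycle_flatten_closed cyc (fconnect_iter t i x)).
apply: eq_card => y; rewrite !inE; apply/idP/idP => /iter_findex <-.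
  by rewrite itE fconnect_iter.
by rewrite -itE fconnect_iter.
Qed.

Lemma sum_cyclen_split t (ss : seq (seq T)) g :
  (forall s, s \in ss -> fcycle t s) -> uniq (flatten ss) ->
  \sum_x g (cyclen t x)
  = \sum_(s <- ss) size s * g (size s) + \sum_(x | x \notin flatten ss) g (cyclen t x).
Proof.
move=> cyc uss; rewrite (bigID (fun x => x \in flatten ss)) /=; congr (_ + _).
by rewrite -(sum_cyclen_flatten g cyc uss) big_uniq.
Qed.

(** Replacing the cycles [ts] by the cycles [us] on the same points leaves all other orbits alone.
    The cycle terms sit on opposite sides to avoid subtraction. *)
Lemma sum_cyclen_change t u (ts us : seq (seq T)) g :
  (forall s, s \in ts -> fcycle t s) -> (forall s, s \in us -> fcycle u s) ->
  uniq (flatten ts) -> perm_eq (flatten ts) (flatten us) ->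
  (forall x, x \notin flatten ts -> u x = t x) ->
  \sum_x g (cyclen u x) + \sum_(s <- ts) size s * g (size s)
  = \sum_x g (cyclen t x) + \sum_(s <- us) size s * g (size s).
Proof.
move=> tcyc ucyc uts tsus tu.
rewrite (sum_cyclen_split g tcyc uts) (sum_cyclen_split g ucyc) -?(perm_uniq tsus) //.
rewrite [in LHS](eq_bigl (fun x => x \notin flatten ts)); last first.
  by move=> x; rewrite (perm_mem tsus).
rewrite [in LHS](eq_bigr (fun x => g (cyclen t x))); last first.
  by move=> x xts; rewrite (cyclen_outside tcyc tu xts).
by rewrite addnC addnA addnAC.
Qed.

Definition ncycles t p : nat := fcard t (order_set t p).

Lemma fclosed_order_set t p : fclosed t (order_set t p).
Proof.
move=> x y /eqP <-; rewrite !inE; congr (_ == _); apply: eq_card => z.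
by rewrite !inE -(same_fconnect1 perm_inj).
Qed.

Lemma ncyclesM t p : ncycles t p * p = \sum_x (cyclen t x == p).
Proof.
rewrite /ncycles (fcard_order_set perm_inj) ?subxx //; last exact: fclosed_order_set.
by rewrite -sum1_card big_mkcond; apply: eq_bigr => x _; rewrite inE; case: eqP.
Qed.

Lemma cyclen_gt0 t x : 0 < cyclen t x. Proof. exact: fingraph.order_gt0. Qed.

Lemma cyclen_le t x : cyclen t x <= #|T|. Proof. exact: max_card. Qed.

Lemma sum_cyclen t g :
  \sum_x g (cyclen t x) = \sum_(i < #|T|) i.+1 * ncycles t i.+1 * g i.+1.
Proof.
transitivity (\sum_x \sum_(i < #|T|) (cyclen t x == i.+1) * g i.+1).
  apply: eq_bigr => x _; have := cyclen_le t x; rewrite -(prednK (cyclen_gt0 t x)) => xT.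
  rewrite (bigD1 (Ordinal xT)) //= eqxx mul1n big1 ?addn0 // => i.
  by rewrite -val_eqE /= eqSS eq_sym => /negPf ->.
rewrite exchange_big; apply: eq_bigr => i _ /=.
by rewrite -big_distrl /= -ncyclesM [X in X * _]mulnC.
Qed.

(** Taking for [g] the indicator of [p] recovers [p * ncycles t p]; cycle types can thus be compared
    through sums over points. *)
Lemma ncycles_eqP t u :
  (forall p, ncycles t p = ncycles u p) <->
  (forall g, \sum_x g (cyclen t x) = \sum_x g (cyclen u x)).
Proof.
split=> [tu g|tu [|p]].
- by rewrite !sum_cyclen; apply: eq_bigr => i _; rewrite tu.
- suff z v : ncycles v 0 = 0 by rewrite !z.
  by apply: eq_card0 => x; rewrite !inE -leqn0 leqNgt cyclen_gt0 andbF.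
- by apply/eqP; rewrite -(eqn_pmul2r (ltn0Sn p)) !ncyclesM (tu (fun k => k == p.+1)).
Qed.

Lemma iter_conjg t v i x : v (iter i t x) = iter i (t ^ v)%g (v x).
Proof. by elim: i => //= i <-; rewrite conjgE !permM permK. Qed.

Lemma cyclen_conjg t v x : cyclen (t ^ v)%g (v x) = cyclen t x.
Proof.
rewrite /fingraph.order -[RHS](card_image (@perm_inj T v)); apply: eq_card => y.
rewrite !inE; apply/idP/imageP => [/iter_findex <-|[z tz ->]].
  by rewrite -iter_conjg; exists (iter (findex (t ^ v)%g (v x) y) t x); rewrite ?inE ?fconnect_iter.
by rewrite -(iter_findex (tz : fconnect t x z)) iter_conjg fconnect_iter.
Qed.

Lemma sum_cyclen_conjg t v g :
  \sum_x g (cyclen (t ^ v)%g x) = \sum_x g (cyclen t x).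
Proof.
rewrite (reindex_inj (@perm_inj T v)).
by apply: eq_bigr => x _; rewrite cyclen_conjg.
Qed.

(* Matching the roots of the cycles of equal length extends along the cycles. *)
Lemma ncycles_conjg t u :
  (forall p, ncycles t p = ncycles u p) -> exists v, u = (t ^ v)%g.
Proof.
move=> tu.
pose R (w : {perm T}) p := enum [predI froots w & order_set w p].
have szR p : size (R t p) = size (R u p) by rewrite -!cardE; exact: tu.
have RP (w : {perm T}) p x : (x \in R w p) = (froots w x && (cyclen w x == p)).
  by rewrite mem_enum.
(* The [k]-th root of a [t]-cycle of given length is matched with the [k]-th root of a [u]-cycle of
   that length. *)
pose h r := nth r (R u (cyclen t r)) (index r (R t (cyclen t r))).
have hP r : froots t r -> froots u (h r) /\ cyclen u (h r) = cyclen t r.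
  move=> tr; have : h r \in R u (cyclen t r).
    by rewrite mem_nth // -szR index_mem RP tr eqxx.
  by rewrite RP => /andP[? /eqP].
have h_inj r r' : froots t r -> froots t r' -> h r = h r' -> r = r'.
  move=> tr tr' hh; have [_ E] := hP r tr; have [_ E'] := hP r' tr'.
  have er : cyclen t r = cyclen t r' by rewrite -E -E' hh.
  move: hh; rewrite /h er (set_nth_default r') => [/eqP|]; last first.
    by rewrite -szR index_mem RP tr er eqxx.
  have ri : r \in R t (cyclen t r') by rewrite RP tr er eqxx.
  have ri' : r' \in R t (cyclen t r') by rewrite RP tr' eqxx.
  rewrite nth_uniq ?enum_uniq // -?szR ?index_mem // => /eqP ii.
  by rewrite -(nth_index r ri) ii nth_index.
pose rt := froot t.
have symc w : connect_sym (frel (w : {perm T})) by exact: (fconnect_sym perm_inj).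
have rtr x : froots t (rt x) by exact: roots_root.
have rtc x : fconnect t (rt x) x by rewrite symc connect_root.
pose phi x := iter (findex t (rt x) x) u (h (rt x)).
have iter_modn (w : {perm T}) k x : iter (k %% cyclen w x) w x = iter k w x.
  rewrite [in RHS](divn_eq k (cyclen w x)) addnC iterD; congr iter.
  elim: (k %/ _) => //= q IHq.
  by rewrite mulSn iterD -IHq (iter_order perm_inj).
(* Valid for every [k], also past a full turn, because matched cycles have equal length. *)
have phi_iter r k : froots t r -> phi (iter k t r) = iter k u (h r).
  move=> tr; have rE : rt (iter k t r) = r.
    rewrite -[RHS](eqP tr); apply/esym/(fingraph.rootP (symc t)); exact: fconnect_iter.
  have [_ E] := hP r tr.
  rewrite /phi rE -[in findex _ _ _]iter_modn findex_iter ?ltn_mod ?cyclen_gt0 //.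
  by rewrite -E iter_modn.
have phiS x : phi (t x) = u (phi x).
  by rewrite -{1}(iter_findex (rtc x)) -iterS phi_iter.
have phi_inj : injective phi.
  move=> x y; rewrite /phi => exy.
  have : froot u (h (rt x)) = froot u (h (rt y)).
    apply/(fingraph.rootP (symc u)); apply: connect_trans (fconnect_iter u (findex t (rt x) x) _) _.
    by rewrite exy symc fconnect_iter.
  have [rx Ex] := hP _ (rtr x); have [ry Ey] := hP _ (rtr y).
  rewrite (eqP rx) (eqP ry) => /h_inj rxy.
  rewrite -(iter_findex (rtc x)) -(iter_findex (rtc y)) -rxy //; congr iter.
  move: exy; rewrite -rxy // => /(congr1 (findex u (h (rt x)))).
  by rewrite !findex_iter // Ex; apply: findex_max; rewrite // rxy.
exists (perm phi_inj); apply/permP => y.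
by rewrite conjgE !permM permE phiS -[phi _](permE phi_inj) permKV.
Qed.

Lemma class_ncyclesP t u :
  reflect (forall p, ncycles u p = ncycles t p) (u \in t ^: [set: {perm T}])%g.
Proof.
apply: (iffP imsetP) => [[v _ ->]|tu].
  by apply/ncycles_eqP => g; rewrite sum_cyclen_conjg.
by have [|v ->] := @ncycles_conjg t u; [move=> p; rewrite tu|exists v; rewrite ?inE].
Qed.

(** The product of the cyclic shifts [next s], whose supports are disjoint. *)
Lemma perm_of_cycles (ss : seq (seq T)) : uniq (flatten ss) ->
  exists t : {perm T}, (forall s, s \in ss -> fcycle t s)
    /\ (forall x, x \notin flatten ss -> t x = x).
Proof.
elim: ss => [|s ss IHss] /=; first by exists 1%g; split=> // x _; rewrite perm1.
rewrite cat_uniq => /and3P[us dis /IHss[t [cyc fix_t]]].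
pose c := perm (can_inj (prev_next us)).
have disj x : x \in s -> x \notin flatten ss.
  by move=> xs; apply: contra dis => xss; apply/hasP; exists x.
have cE x : x \notin s -> c x = x by move=> /negPf xs; rewrite permE next_nth xs.
exists (c * t)%g; split=> [s'|x]; last first.
  by rewrite mem_cat negb_or => /andP[xs xss]; rewrite permM cE // fix_t.
rewrite inE => /predU1P[->|s'ss].
  have E : {in s &, frel (c * t)%g =2 frel (next s)}.
    by move=> x y xs _; rewrite /= permM permE fix_t // disj // mem_next.
  by rewrite (eq_in_cycle E (allss s)) cycle_next.
have E : {in s' &, frel (c * t)%g =2 frel t}.
  move=> x y xs' _; rewrite /= permM cE //; apply/negP => /disj/negP; apply.
  by apply/flattenP; exists s'.
by rewrite (eq_in_cycle E (allss s')) cyc.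
Qed.

End CycleSums.

(** * Multiplication by a 3-cycle *)

Ltac perm_count := apply/seq.permP => ?; rewrite /= ?count_cat /= ?count_cat /= ?count_cat /=; lia.

Section Surgery.
Variable T : finType.
Implicit Types (a b d : T) (A B C D : seq T).

Lemma path_cut (e : rel T) a A b X :
  path e a (A ++ b :: X) = path e a (rcons A b) && path e b X.
Proof. by rewrite -cat_rcons cat_path last_rcons. Qed.

(** Only the first arrow changes: from [x'], [u] enters the segment that [t] enters from [x]. *)
Lemma path_splice (t u : T -> T) x x' A y :
  u x' = t x -> {in A, u =1 t} -> fpath t x (rcons A y) -> fpath u x' (rcons A y).
Proof.
elim: A x x' => [|z A IHA] x x' /= -> uA //; case/andP=> -> /= /IHA; apply.
  by rewrite uA ?mem_head.
by move=> w wA; rewrite uA // inE wA orbT.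
Qed.

(** The hypotheses describe [u = c3 a b d * t], in which the 3-cycle acts first. Each surgery cuts
    the cycles of [t] after [a], [b], [d] and rejoins the segments; [\sum_x cyclen t x] is the sum
    of the squares of the cycle lengths. *)
Variables (t u : {perm T}) (a b d : T).
Hypotheses (ua : u a = t b) (ub : u b = t d) (ud : u d = t a).
Hypothesis uo : forall x, x != a -> x != b -> x != d -> u x = t x.

Let off s : uniq [:: a, b, d & s] -> {in s, u =1 t}.
Proof.
rewrite /= !inE !negb_or => /and4P[/and3P[_ _ as_] /andP[_ bs] ds _] z zs.
by apply: uo; [apply: contraNneq as_|apply: contraNneq bs|apply: contraNneq ds] => <-.
Qed.

(* In continuation style, to leave the side conditions as goals. *)
Let change ts us g (P : Prop) :
  all (fun s => fcycle t s) ts -> all (fun s => fcycle u s) us ->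
  perm_eq (flatten ts) (flatten us) -> uniq (flatten ts) ->
  [&& a \in flatten ts, b \in flatten ts & d \in flatten ts] ->
  (\sum_x g (cyclen u x) + \sum_(s <- ts) size s * g (size s)
  = \sum_x g (cyclen t x) + \sum_(s <- us) size s * g (size s) -> P) -> P.
Proof.
move=> /allP ct /allP cu tsus uts /and3P[sa sb sd]; apply; apply: sum_cyclen_change => // x sx.
by apply: uo; apply: contraNneq sx => ->.
Qed.

Let seg x x' A y s : uniq [:: a, b, d & s] -> {subset A <= s} -> u x' = t x ->
  fpath t x (rcons A y) -> fpath u x' (rcons A y).
Proof. by move=> /off us As ux; apply: path_splice => // z /As /us. Qed.

(** The three segments are rejoined, in another order, into one cycle of the same length. *)
Lemma surgery_rotate A B C (s := a :: A ++ b :: B ++ d :: C) :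
  fcycle t s -> uniq s -> forall g, \sum_x g (cyclen u x) = \sum_x g (cyclen t x).
Proof.
move=> ct us g; pose s' := a :: B ++ d :: A ++ b :: C.
have un : uniq [:: a, b, d & A ++ B ++ C].
  by rewrite -(perm_uniq (s1 := s)) //; perm_count.
have cu : fcycle u s'.
  move: ct; rewrite /= !(rcons_cat, rcons_cons) !path_cut => /and3P[tA tB tC].
  by apply/and3P; split; [move: tB | move: tA | move: tC]; apply: (seg un) => // z zA;
    rewrite !mem_cat zA ?orbT.
apply: (@change [:: s] [:: s'] g).
- by rewrite /= andbT.
- by rewrite /= andbT.
- by perm_count.
- by rewrite /= cats0.
- by rewrite /= !(inE, mem_cat) !eqxx !orbT.
rewrite !big_seq1 (_ : size s' = size s); first exact: addIn.
by rewrite /= !size_cat /= !size_cat /=; lia.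
Qed.

(** In the opposite cyclic order each segment closes up separately; breaking one cycle into three
    lowers the sum of squares. *)
Lemma surgery_split A B C (s := a :: A ++ d :: B ++ b :: C) :
  fcycle t s -> uniq s -> \sum_x cyclen u x < \sum_x cyclen t x.
Proof.
move=> ct us; have un : uniq [:: a, b, d & A ++ B ++ C].
  by rewrite -(perm_uniq (s1 := s)) //; perm_count.
have /and3P[cu1 cu2 cu3] : [&& fcycle u (a :: C), fcycle u (d :: A) & fcycle u (b :: B)].
  move: ct; rewrite /= !(rcons_cat, rcons_cons) !path_cut => /and3P[tA tB tC].
  by apply/and3P; split; [move: tC | move: tA | move: tB]; apply: (seg un) => // z zA;
    rewrite !mem_cat zA ?orbT.
apply: (@change [:: s] [:: a :: C; d :: A; b :: B] id).
- by rewrite /= andbT.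
- by rewrite /= andbT; apply/and3P.
- by perm_count.
- by rewrite /= cats0.
- by rewrite /= !(inE, mem_cat) !eqxx !orbT.
by rewrite !big_cons !big_nil /= !size_cat /= !size_cat /=; nia.
Qed.

(* Comparing the sums of squares of cycle lengths, only the exchange of the two lengths survives. *)
Lemma surgery_exchange A B D (s := a :: A ++ b :: B) (s2 := d :: D) :
  fcycle t s -> fcycle t s2 -> uniq (s ++ s2) ->
  (size B = size D -> forall g, \sum_x g (cyclen u x) = \sum_x g (cyclen t x))
  /\ (\sum_x cyclen u x = \sum_x cyclen t x -> size B = size D).
Proof.
move=> ct ct2 us; have un : uniq [:: a, b, d & A ++ B ++ D].
  by rewrite -(perm_uniq (s1 := s ++ s2)) //; perm_count.
have /andP[cu1 cu2] : fcycle u (a :: B) && fcycle u (b :: D ++ d :: A).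
  move: ct ct2; rewrite /= !(rcons_cat, rcons_cons) !path_cut => /andP[tA tB] tD.
  by apply/and3P; split; [move: tB | move: tD | move: tA]; apply: (seg un) => // z zA;
    rewrite !mem_cat zA ?orbT.
have H g : \sum_x g (cyclen u x) + ((size A + (size B).+1).+1 * g (size A + (size B).+1).+1
      + (size D).+1 * g (size D).+1)
  = \sum_x g (cyclen t x) + ((size B).+1 * g (size B).+1
      + (size D + (size A).+1).+1 * g (size D + (size A).+1).+1).
  apply: (@change [:: s; s2] [:: a :: B; b :: D ++ d :: A] g).
  - by rewrite /= andbT; apply/andP.
  - by rewrite /= andbT; apply/andP.
  - by perm_count.
  - by rewrite /= cats0.
  - by rewrite /= !(inE, mem_cat) !eqxx !orbT.
  by rewrite !big_cons !big_nil /= !size_cat /= !addn0.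
split=> [BD g|E].
  have := H g; rewrite BD (_ : size A + (size D).+1 = size D + (size A).+1) ?addnS 1?addnC //.
  lia.
by have := H id; rewrite /= E; nia.
Qed.

(** Three cycles are joined into one, which raises the sum of squares. *)
Lemma surgery_merge A B D (s1 := a :: A) (s2 := b :: B) (s3 := d :: D) :
  fcycle t s1 -> fcycle t s2 -> fcycle t s3 -> uniq (s1 ++ s2 ++ s3) ->
  \sum_x cyclen t x < \sum_x cyclen u x.
Proof.
move=> ct1 ct2 ct3 us; have un : uniq [:: a, b, d & A ++ B ++ D].
  by rewrite -(perm_uniq (s1 := s1 ++ s2 ++ s3)) //; perm_count.
have cu : fcycle u (a :: B ++ b :: D ++ d :: A).
  rewrite /= !(rcons_cat, rcons_cons) !path_cut.
  by apply/and3P; split; [move: ct2 | move: ct3 | move: ct1]; apply: (seg un) => // z zA;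
    rewrite !mem_cat zA ?orbT.
apply: (@change [:: s1; s2; s3] [:: a :: B ++ b :: D ++ d :: A] id).
- by rewrite /= andbT; apply/and3P.
- by rewrite /= andbT.
- by perm_count.
- by rewrite /= cats0.
- by rewrite /= !(inE, mem_cat) !eqxx !orbT.
by rewrite !big_cons !big_nil /= !size_cat /= !size_cat /=; nia.
Qed.

End Surgery.

(** * 3-cycles as ordered triples of distinct points *)

Section ThreeCycles.
Variable T : finType.
Implicit Types (a b d : T).

(** The cycle sending [a] to [b], [b] to [d] and [d] to [a], as products act from left to right. *)
Definition c3 a b d : {perm T} := (tperm a b * tperm a d)%g.

Definition distinct3 a b d := [&& a != b, b != d & a != d].

Lemma distinct3_rot a b d : distinct3 a b d = distinct3 b d a.
Proof. by rewrite /distinct3 [a == b]eq_sym [a == d]eq_sym andbC -andbA. Qed.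

Lemma c3E a b d : distinct3 a b d ->
  [/\ c3 a b d a = b, c3 a b d b = d, c3 a b d d = a
    & forall x, x != a -> x != b -> x != d -> c3 a b d x = x].
Proof.
case/and3P=> ab bd ad; split=> [|||x xa xb xd]; rewrite permM.
- by rewrite tpermL tpermD // eq_sym.
- by rewrite tpermR tpermL.
- by rewrite (@tpermD _ a b d) // tpermR.
- by rewrite !tpermD // eq_sym.
Qed.

Lemma eq_c3 (c : {perm T}) a b d : distinct3 a b d ->
  c a = b -> c b = d -> c d = a ->
  (forall x, x != a -> x != b -> x != d -> c x = x) -> c = c3 a b d.
Proof.
move=> abd ca cb cd co; have [ea eb ed eo] := c3E abd; apply/permP => x.
have [->|xa] := eqVneq x a; first by rewrite ca ea.
have [->|xb] := eqVneq x b; first by rewrite cb eb.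
have [->|xd] := eqVneq x d; first by rewrite cd ed.
by rewrite co // eo.
Qed.

Lemma c3_rot a b d : distinct3 a b d -> c3 a b d = c3 b d a.
Proof.
move=> abd; have [ea eb ed eo] := c3E abd; apply: eq_c3 => //.
  by rewrite -distinct3_rot.
by move=> x xb xd xa; rewrite eo.
Qed.

Lemma is_3cycleP (c : {perm T}) :
  reflect (exists a b d, distinct3 a b d /\ c = c3 a b d) (is_3cycle c).
Proof.
apply: (iffP existsP) => [[a /existsP[b /existsP[d]]]|[a [b [d [abd ->]]]]].
  case/and5P=> ab bd ad /andP[/andP[/eqP ca /eqP cb] /eqP cd] /forallP co.
  have abd : distinct3 a b d by apply/and3P.
  exists a, b, d; split=> //; apply: eq_c3 => // x xa xb xd.
  by have := co x; rewrite xa xb xd => /eqP.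
have [ea eb ed eo] := c3E abd; exists a; apply/existsP; exists b; apply/existsP; exists d.
case/and3P: abd => -> -> ->; rewrite ea eb ed !eqxx /=.
by apply/forallP => x; apply/implyP => /and3P[xa xb xd]; rewrite eo.
Qed.

Lemma c3_moved a b d x : distinct3 a b d -> (c3 a b d x != x) = (x \in [:: a; b; d]).
Proof.
move=> abd; have [ea eb ed eo] := c3E abd; case/and3P: abd => ab bd ad.
rewrite !inE; have [->|xa] := eqVneq x a; first by rewrite ea eq_sym.
have [->|xb] := eqVneq x b; first by rewrite eb eq_sym.
have [->|xd] := eqVneq x d; first by rewrite ed.
by rewrite eo ?eqxx.
Qed.

Lemma is_3cycle_moved (c : {perm T}) : is_3cycle c -> #|[pred x | c x != x]| = 3.
Proof.
case/is_3cycleP=> a [b [d [abd ->]]].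
rewrite (eq_card (B := mem [:: a; b; d])) => [|x]; last by rewrite inE c3_moved.
apply/card_uniqP; case/and3P: abd => ab bd ad.
by rewrite /= !inE negb_or ab bd ad.
Qed.

Lemma is_3cycle_c3 (c : {perm T}) a : is_3cycle c -> c a != a ->
  distinct3 a (c a) (c (c a)) /\ c = c3 a (c a) (c (c a)).
Proof.
case/is_3cycleP=> x [y [z [xyz ->]]]; rewrite c3_moved //.
have [ex ey ez eo] := c3E xyz.
rewrite !inE => /or3P[] /eqP ->; rewrite ?(ex, ey, ez) //.
- by split; [rewrite -distinct3_rot | exact: c3_rot].
- by split; rewrite 1?[RHS]c3_rot // distinct3_rot.
Qed.

(** A 3-cycle has three moved points, and with a moved point [a] as start it is determined by the
    pair [(c a, c (c a))]. *)
Lemma count_3cycles (P : pred {perm T}) :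
  3 * #|[set c : {perm T} | is_3cycle c & P c]|
  = \sum_a \sum_b \sum_d (distinct3 a b d && P (c3 a b d)).
Proof.
rewrite -sum1_card big_distrr /=.
transitivity (\sum_(c | is_3cycle c && P c) \sum_(a | c a != a) 1).
  apply: eq_big => [c|c]; first by rewrite inE.
  by rewrite inE => /andP[c3c _]; rewrite sum1_card is_3cycle_moved.
rewrite (exchange_big_dep predT) //=; apply: eq_bigr => a _.
rewrite pair_big /= (eq_bigr (fun p => if distinct3 a p.1 p.2 && P (c3 a p.1 p.2) then 1 else 0)).
  rewrite -big_mkcond /=.
  rewrite (reindex_onto (fun c : {perm T} => (c a, c (c a))) (fun p => c3 a p.1 p.2)) /=.
    apply: eq_bigl => c; apply/idP/idP.
      case/andP=> /andP[c3c Pc] ca; have [da eqc] := is_3cycle_c3 c3c ca.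
      by rewrite da -eqc Pc eqxx.
    case/andP=> /andP[da Pc] /eqP eqc; rewrite eqc in Pc; rewrite Pc andbT; apply/andP; split.
      by apply/is_3cycleP; exists a, (c a), (c (c a)).
    by case/and3P: da => aca _ _; rewrite eq_sym.
  by case=> b d /= /andP[abd _]; have [-> -> _ _] := c3E abd.
by move=> p _; case: ifP.
Qed.

End ThreeCycles.

(** * Counting the 3-cycles that preserve the cycle type of [t] *)

Section TypePreserving.
Variables (T : finType) (t : {perm T}).
Implicit Types (a b d : T).

Definition preserves_type (c : {perm T}) := (c * t \in t ^: [set: {perm T}])%g.

Lemma preserves_typeP (c : {perm T}) :
  reflect (forall g, \sum_x g (cyclen (c * t)%g x) = \sum_x g (cyclen t x))
          (preserves_type c).
Proof.
by apply: (iffP (class_ncyclesP t (c * t)%g)) => H; [exact/ncycles_eqP|apply/ncycles_eqP].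
Qed.

Lemma orbit_cons a : fingraph.orbit t a = a :: behead (fingraph.orbit t a).
Proof. by rewrite /fingraph.orbit -orderSpred. Qed.

Lemma fcycle_orbit a : fcycle t (fingraph.orbit t a).
Proof. exact: cycle_orbit perm_inj _. Qed.

Lemma index_uniq_cat (s s1 s2 : seq T) x :
  uniq s -> s = s1 ++ x :: s2 -> index x s = size s1.
Proof.
move=> us E; move: us; rewrite E cat_uniq => /and3P[_ /hasPn/(_ x (mem_head _ _)) /= /negPf xs _].
by rewrite index_cat xs /= eqxx addn0.
Qed.

Section Triple.
Variables (a b d : T) (abd : distinct3 a b d).

Let u := (c3 a b d * t)%g.

Let ua : u a = t b. Proof. by rewrite permM; have [-> _ _ _] := c3E abd. Qed.
Let ub : u b = t d. Proof. by rewrite permM; have [_ -> _ _] := c3E abd. Qed.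
Let ud : u d = t a. Proof. by rewrite permM; have [_ _ -> _] := c3E abd. Qed.
Let uo x : x != a -> x != b -> x != d -> u x = t x.
Proof. by move=> xa xb xd; rewrite permM; have [_ _ _ ->] := c3E abd. Qed.

Let orbit_split : fconnect t a b ->
  exists A B, fingraph.orbit t a = a :: A ++ b :: B.
Proof.
case/and3P: abd => ab _ _; rewrite fconnect_orbit orbit_cons inE eq_sym (negPf ab) /=.
by case/splitPr=> A B; exists A, B.
Qed.

(** Reading the cycle from [a], meeting [b] before [d] is the rotation case; meeting [d] first
    splits the cycle in three and changes the sum of squares. *)
Lemma preserves_type_same : fconnect t a b -> fconnect t a d ->
  preserves_type (c3 a b d) = (findex t a b < findex t a d).
Proof.
move=> /orbit_split[A [X oE]]; have := fcycle_orbit a; have := orbit_uniq t a.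
rewrite fconnect_orbit /findex oE; case/and3P: abd => ab bd ad.
rewrite inE mem_cat inE (eq_sym d a) (negPf ad) (eq_sym d b) (negPf bd) !orFb.
move=> us cs /orP[] /splitPr dX; case: dX us cs => [B C] us cs.
  rewrite -catA cat_cons in us cs *.
  have H := surgery_split ua ub ud uo cs us.
  transitivity false; first by apply/preserves_typeP => /(_ id) /= E; rewrite E ltnn in H.
  apply/esym/negbTE; rewrite -leqNgt.
  rewrite (@index_uniq_cat _ (a :: B) (C ++ b :: X) d us) //.
  rewrite (@index_uniq_cat _ (a :: B ++ d :: C) X b us) /= -?catA // size_cat; lia.
have H := surgery_rotate ua ub ud uo cs us.
transitivity true; first exact/preserves_typeP.
apply/esym.
rewrite (@index_uniq_cat _ (a :: A) (B ++ d :: C) b us) //.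
by rewrite (@index_uniq_cat _ (a :: A ++ b :: B) C d us) /= -?catA // size_cat /=; lia.
Qed.

Let uniq_orbits x y : ~~ fconnect t x y ->
  uniq (fingraph.orbit t x ++ fingraph.orbit t y).
Proof.
move=> xy; rewrite cat_uniq !orbit_uniq andbT /=; apply/hasPn => z.
rewrite -!fconnect_orbit => yz; apply: contra xy => xz.
by apply: connect_trans xz _; rewrite (fconnect_sym perm_inj).
Qed.

(** With [A], [B] the segments after [a] and [b] and [D] the one after [d], the condition
    [size B = size D] of [surgery_exchange] becomes the stated equation. *)
Lemma preserves_type_pair : fconnect t a b -> ~~ fconnect t a d ->
  preserves_type (c3 a b d) = (findex t a b + cyclen t d == cyclen t a).
Proof.
move=> /orbit_split[A [B oE]] ad; have us := uniq_orbits ad.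
have ca := fcycle_orbit a; have cd := fcycle_orbit d; have ua' := orbit_uniq t a.
rewrite -!(size_orbit t) /findex; rewrite oE (orbit_cons d) in us ca cd ua' *.
have [H1 H2] := surgery_exchange ua ub ud uo ca cd us.
rewrite (@index_uniq_cat _ (a :: A) B b ua') // /= size_cat /= !addSn eqSS eqn_add2l eqSS.
apply/preserves_typeP/eqP => [/(_ id) /= /H2 -> //|E].
exact/H1.
Qed.

Lemma preserves_type_apart :
  ~~ fconnect t a b -> ~~ fconnect t a d -> ~~ fconnect t b d ->
  preserves_type (c3 a b d) = false.
Proof.
move=> ab ad bd; apply/negP => /preserves_typeP/(_ id) /= E.
have cE x : fcycle t (x :: behead (fingraph.orbit t x)).
  by rewrite -orbit_cons; exact: fcycle_orbit.
have oE x : x :: behead (fingraph.orbit t x) = fingraph.orbit t x by rewrite -orbit_cons.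
have := surgery_merge ua ub ud uo (cE a) (cE b) (cE d).
rewrite !oE E ltnn => H.
suff /H : uniq (fingraph.orbit t a ++ fingraph.orbit t b ++ fingraph.orbit t d) by [].
have := uniq_orbits ab; have := uniq_orbits ad; have := uniq_orbits bd.
rewrite !cat_uniq has_cat negb_or.
by move=> /and3P[-> -> ->] /and3P[_ -> _] /and3P[-> -> _].
Qed.

End Triple.

Lemma cyclen_fconnect a b : fconnect t a b -> cyclen t a = cyclen t b.
Proof.
move=> ab; apply: eq_card => x; rewrite !inE.
by rewrite (same_connect (fconnect_sym perm_inj) ab).
Qed.

(** The exchange case, with [d] alone on the shorter cycle. In this form [b] is a function of [a]
    and [d], which makes the sum over [b] immediate; [exchE] gives the geometric reading. *)
Definition exch a b d :=
  (cyclen t d < cyclen t a) && (b == iter (cyclen t a - cyclen t d) t a).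

(** The rotation case: [a], [b], [d] follow each other in this cyclic order on one cycle. *)
Definition rota a b d :=
  [&& a != b, fconnect t a b, fconnect t a d & findex t a b < findex t a d].

Lemma exchE a b d : exch a b d =
  [&& a != b, fconnect t a b, ~~ fconnect t a d & findex t a b + cyclen t d == cyclen t a].
Proof.
apply/andP/and4P => [[da /eqP ->]|[ab tab tad /eqP E]].
  have lt : cyclen t a - cyclen t d < cyclen t a by have := cyclen_gt0 t d; lia.
  split; rewrite ?fconnect_iter // ?findex_iter //; last by rewrite subnK // ltnW.
    rewrite -(findex_eq0 t) findex_iter //; lia.
  by apply: contraTN da => /cyclen_fconnect ->; rewrite ltnn.
have fi : 0 < findex t a b by rewrite lt0n findex_eq0.
split; first lia.
by rewrite -E addnK iter_findex.
Qed.

Lemma exch_distinct a b d : exch a b d -> distinct3 a b d.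
Proof.
rewrite exchE => /and4P[ab tab tad _]; rewrite /distinct3 ab /=.
by apply/andP; split; apply: contraNneq tad => <- //; rewrite connect0.
Qed.

Lemma rota_distinct a b d : rota a b d -> distinct3 a b d.
Proof.
case/and4P=> ab _ _ lt; rewrite /distinct3 ab /=; apply/andP; split.
  by apply: contraTneq lt => ->; rewrite ltnn.
by apply: contraTneq lt => <-; rewrite findex0.
Qed.

(** The cases exclude one another: all three points share a cycle, or exactly one of [d], [a], [b]
    lies apart from the other two, or all are apart and the type changes. *)
Lemma preserves_type_c3 a b d :
  distinct3 a b d && preserves_type (c3 a b d)
  = rota a b d + exch a b d + exch b d a + exch d a b :> nat.
Proof.
have sy := fconnect_sym (@perm_inj _ t).
have tr x y z : fconnect t x y -> fconnect t y z -> fconnect t x z.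
  exact: connect_trans.
have [abd|nabd] := boolP (distinct3 a b d); last first.
  have /negPf-> : ~~ rota a b d by apply: contra nabd => /rota_distinct.
  have /negPf-> : ~~ exch a b d by apply: contra nabd => /exch_distinct.
  have /negPf-> : ~~ exch b d a by apply: contra nabd => /exch_distinct; rewrite (distinct3_rot a).
  have /negPf-> // : ~~ exch d a b.
  by apply: contra nabd => /exch_distinct; rewrite (distinct3_rot d).
have bda : distinct3 b d a by rewrite -distinct3_rot.
have dab : distinct3 d a b by rewrite (distinct3_rot d).
rewrite !exchE /rota andTb; have /and3P[-> _ _] := abd.
have /and3P[-> _ _] := bda; have /and3P[-> _ _] := dab.
rewrite (sy b a) (sy d a) (sy d b) !andTb.
have [ab|nab] := boolP (fconnect t a b); have [ad|nad] := boolP (fconnect t a d).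
- have bd : fconnect t b d by apply: tr ad; rewrite sy.
  by rewrite bd /= !addn0 preserves_type_same.
- have /negPf -> : ~~ fconnect t b d by apply: contra nad; exact: tr.
  by rewrite /= !addn0 preserves_type_pair.
- have /negPf -> : ~~ fconnect t b d by apply: contra nab => bd; apply: tr ad _; rewrite sy.
  rewrite /= !add0n -(c3_rot dab) preserves_type_pair //; first by rewrite sy.
  by apply: contra nab => db; apply: tr db.
have [bd|nbd] := boolP (fconnect t b d); last by rewrite /= preserves_type_apart.
by rewrite /= add0n addn0 c3_rot // preserves_type_pair // sy.
Qed.

Lemma sum_exch : \sum_a \sum_b \sum_d exch a b d = \sum_a \sum_d (cyclen t d < cyclen t a).
Proof.
apply: eq_bigr => a _; rewrite exchange_big; apply: eq_bigr => d _.
rewrite (bigD1 (iter (cyclen t a - cyclen t d) t a)) //= /exch eqxx andbT big1 ?addn0 //.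
by move=> b /negPf ->; rewrite andbF.
Qed.

Lemma sum_findex a (F : nat -> nat) :
  \sum_(b | fconnect t a b) F (findex t a b) = \sum_(i < cyclen t a) F i.
Proof.
rewrite (eq_bigl (fun b => b \in fingraph.orbit t a)); last first.
  by move=> b; rewrite -fconnect_orbit.
rewrite -big_uniq ?orbit_uniq // (big_nth a) size_orbit big_mkord.
by apply: eq_bigr => i _; rewrite /= nth_traject // findex_iter.
Qed.

Lemma sum_lt_pairs c :
  2 * \sum_(i < c) \sum_(j < c) ((i != 0 :> nat) && (i < j)) = c.-1 * c.-2.
Proof.
have E (j : nat) : \sum_(i < c) ((i != 0 :> nat) && (i < j)) = (minn j c).-1.
  elim: c => [|c IHc]; first by rewrite big_ord0 minn0.
  by rewrite big_ord_recr /= IHc; lia.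
rewrite exchange_big (eq_bigr (fun j : 'I_c => j.-1)) => [|j _ /=]; last first.
  by rewrite E; have := ltn_ord j; lia.
elim: c {E} => [|c IHc]; first by rewrite big_ord0.
by rewrite big_ord_recr mulnDr IHc /=; case: c {IHc} => [|[|c]] //=; nia.
Qed.

Lemma sum_rota : 2 * (\sum_a \sum_b \sum_d rota a b d)
  = \sum_a (cyclen t a).-1 * (cyclen t a).-2.
Proof.
rewrite big_distrr; apply: eq_bigr => a _ /=; rewrite -sum_lt_pairs; congr (2 * _).
rewrite -(sum_findex a (fun i => \sum_(j < cyclen t a) ((i != 0) && (i < j)))) [RHS]big_mkcond.
apply: eq_bigr => b _; case: ifP => ab; last by rewrite big1 // => d _; rewrite /rota ab andbF.
rewrite -(sum_findex a (fun j => (findex t a b != 0) && (findex t a b < j))) [RHS]big_mkcond.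
by apply: eq_bigr => d _; rewrite /rota ab findex_eq0; case: (fconnect t a d) => //; rewrite andbF.
Qed.

(** The factor 6 combines the three starting points of a 3-cycle with the halving in [sum_rota]. The
    three [exch] sums agree after renaming the points. *)
Lemma count_type_preserving :
  6 * #|[set c : {perm T} | is_3cycle c & preserves_type c]|
  = \sum_a (cyclen t a).-1 * (cyclen t a).-2 + 6 * \sum_a \sum_d (cyclen t d < cyclen t a).
Proof.
have := count_3cycles preserves_type.
rewrite (eq_bigr (fun a => \sum_b \sum_d rota a b d + \sum_b \sum_d exch a b d
    + \sum_b \sum_d exch b d a + \sum_b \sum_d exch d a b)); last first.
  move=> a _; rewrite -!big_split; apply: eq_bigr => b _ /=.
  by rewrite -!big_split; apply: eq_bigr => d _ /=; rewrite preserves_type_c3.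
have R1 : \sum_a \sum_b \sum_d exch b d a = \sum_a \sum_b \sum_d exch a b d.
  by rewrite exchange_big; apply: eq_bigr => b _; rewrite exchange_big.
have R2 : \sum_a \sum_b \sum_d exch d a b = \sum_a \sum_b \sum_d exch a b d.
  rewrite (eq_bigr (fun a => \sum_d \sum_b exch d a b)); last by move=> a _; rewrite exchange_big.
  by rewrite exchange_big.
rewrite !big_split /= R1 R2 sum_exch -sum_rota; lia.
Qed.

(** All ordered pairs of points are split by comparing their cycle lengths; those of equal length
    [p] number [(p * ncycles t p) ^ 2]. *)
Lemma sum_cyclen_lt :
  2 * (\sum_a \sum_d (cyclen t d < cyclen t a))
  + \sum_(i < #|T|) (i.+1 * ncycles t i.+1) ^ 2 = #|T| ^ 2.
Proof.
have S : \sum_a \sum_d (cyclen t a < cyclen t d) = \sum_a \sum_d (cyclen t d < cyclen t a).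
  by rewrite exchange_big.
have Q : \sum_a \sum_d (cyclen t d == cyclen t a)
    = \sum_(i < #|T|) (i.+1 * ncycles t i.+1) ^ 2.
  rewrite (eq_bigr (fun a => ncycles t (cyclen t a) * cyclen t a)); last first.
    by move=> a _; rewrite ncyclesM.
  rewrite (sum_cyclen t (fun p => ncycles t p * p)).
  by apply: eq_bigr => i _; rewrite [X in _ * X]mulnC mulnn.
rewrite -Q mul2n -addnn -{1}S -!big_split /=.
rewrite (eq_bigr (fun=> #|T|)) ?sum_nat_const ?mulnn // => a _.
rewrite -!big_split /= -sum1_card; apply: eq_bigr => d _.
by case: ltngtP.
Qed.

(** To fit [sum_partitions], [m^2] is written [m (m + 1) - m], where [m (m + 1)] is twice the sum of
    the [j <= m]. The correction [3 p^2 m] turns [p (p - 1) (p - 2)] into [p^3 + 2p]. *)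
Lemma count_type_preserving_ncycles :
  6 * #|[set c : {perm T} | is_3cycle c & preserves_type c]|
  + \sum_(i < #|T|) \sum_(1 <= j < (ncycles t i.+1).+1) 6 * (i.+1 * (i.+1 * j))
  = \sum_(i < #|T|) \sum_(1 <= j < (ncycles t i.+1).+1) (i.+1 ^ 3 + 2 * i.+1)
    + 3 * #|T| ^ 2.
Proof.
rewrite count_type_preserving -sum_cyclen_lt.
rewrite (sum_cyclen t (fun p => p.-1 * p.-2)) /=.
suff: \sum_(i < #|T|) i.+1 * ncycles t i.+1 * (i * i.-1)
    + \sum_(i < #|T|) \sum_(1 <= j < (ncycles t i.+1).+1) 6 * (i.+1 * (i.+1 * j))
  = \sum_(i < #|T|) \sum_(1 <= j < (ncycles t i.+1).+1) (i.+1 ^ 3 + 2 * i.+1)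
    + 3 * \sum_(i < #|T|) (i.+1 * ncycles t i.+1) ^ 2.
  by move=> H; rewrite addnAC H -addnA mulnDr mulnA; congr (_ + _); rewrite addnC.
rewrite big_distrr -!big_split /=; apply: eq_bigr => i _.
rewrite sum_nat_const_nat subn1 /=; move: (ncycles t i.+1) => m.
have J : 2 * \sum_(1 <= j < m.+1) j = m * m.+1.
  by elim: m => [|m IHm]; [rewrite big_geq | rewrite big_nat_recr //= mulnDr IHm; nia].
have -> : \sum_(1 <= j < m.+1) 6 * (i.+1 * (i.+1 * j)) = 3 * (i.+1 * i.+1 * (m * m.+1)).
  by rewrite -J -!big_distrr /=; nia.
by case: (nat_of_ord i) => [|k] /=; nia.
Qed.

End TypePreserving.

(** * Summation over cycle types *)

(** The fibres of [s] going to [t ^ s] are the right cosets of the centralizer of [t]. *)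
Lemma card_conjg_pred (gT : finGroupType) (t : gT) (P : pred gT) :
  #|[set s | P (t ^ s)%g]| = #|'C[t]%g| * #|[set u in (t ^: [set: gT])%g | P u]|.
Proof.
rewrite -sum1_card (partition_big (conjg t) [in [set u in (t ^: [set: gT])%g | P u]]) /=.
  rewrite -[X in _ = _ * X]sum1_card big_distrr /=; apply: eq_bigr => u.
  rewrite inE => /andP[/imsetP[v _ ->] Pu]; rewrite muln1 -(card_rcoset _ v) -sum1_card.
  apply: eq_bigl => s; rewrite mem_rcoset inE.
  have -> : (s * v^-1 \in 'C[t])%g = (t ^ s == t ^ v)%g.
    rewrite -(inj_eq (conjg_inj v^-1)%g) -!conjgM mulgV conjg1.
    apply/cent1P/eqP => [c|c]; first by rewrite conjgE -c mulKg.
    by rewrite /commute [RHS]conjgC c.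
  by case: eqP => [->|_]; rewrite ?andbF ?Pu.
by move=> s; rewrite !inE => ->; rewrite andbT memJ_class // inE.
Qed.

Lemma card_class_cent1 (gT : finGroupType) (t : gT) :
  #|'C[t]%g| * #|(t ^: [set: gT])%g| = #|gT|.
Proof.
have := card_conjg_pred t predT; rewrite -cardsT => E; transitivity #|[set s | predT (t ^ s)%g]|.
  by rewrite E; congr (_ * _); apply: eq_card => u; rewrite !inE andbT.
by apply: eq_card => s; rewrite !inE.
Qed.

Section CycleType.
Variable n : nat.
Implicit Types (t u : 'S_n) (f : {ffun 'I_n -> 'I_n.+1}).

Definition cycle_type t : {ffun 'I_n -> 'I_n.+1} :=
  [ffun i : 'I_n => inord (ncycles t i.+1)].

Lemma cycle_typeE t i : cycle_type t i = ncycles t i.+1 :> nat.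
Proof.
by rewrite ffunE inordK // ltnS; apply: leq_trans (max_card _) _; rewrite card_ord.
Qed.

Lemma sum_cyclen_ord t (g : nat -> nat) :
  \sum_x g (cyclen t x) = \sum_(i < n) i.+1 * cycle_type t i * g i.+1.
Proof.
rewrite sum_cyclen card_ord.
by apply: eq_bigr => i _; rewrite cycle_typeE.
Qed.

Lemma cycle_type_partition t : cycle_type t \in partitions_in n n.
Proof.
rewrite inE -[X in _ == X]card_ord -sum1_card (sum_cyclen_ord t (fun=> 1)).
by apply/eqP; apply: eq_bigr => i _; rewrite muln1.
Qed.

Lemma cycle_type_eq t u : (cycle_type u == cycle_type t) = (u \in t ^: [set: 'S_n])%g.
Proof.
apply/eqP/class_ncyclesP => [E|E].
  by apply/ncycles_eqP => g; rewrite !sum_cyclen_ord E.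
by apply: eq_ffun => i; rewrite E.
Qed.

(** The list of all points is cut into [f i] consecutive blocks of each length [i.+1], and the
    blocks are taken as cycles. *)
Lemma cycle_type_surj f : f \in partitions_in n n -> exists t, cycle_type t = f.
Proof.
rewrite inE => /eqP fn.
pose sh := flatten [seq nseq (f i) i.+1 | i <- enum 'I_n].
have shE (F : nat -> nat) : \sum_(k <- sh) F k = \sum_(i < n) f i * F i.+1.
  rewrite big_flatten big_map big_enum; apply: eq_bigr => i _.
  by rewrite big_nseq iter_addn_0 mulnC.
have shn : sumn sh = size (enum 'I_n).
  rewrite sumnE (shE id) size_enum_ord -[RHS]fn.
  by apply: eq_bigr => i _; rewrite mulnC.
pose ss := reshape sh (enum 'I_n).
have fss : flatten ss = enum 'I_n by rewrite reshapeKr // shn.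
have [|t [ct _]] := @perm_of_cycles _ ss; first by rewrite fss enum_uniq.
exists t; apply/ffunP => i; apply: val_inj; rewrite /= cycle_typeE.
apply/eqP; rewrite -(eqn_pmul2r (ltn0Sn i)) ncyclesM.
rewrite (sum_cyclen_split (fun k => k == i.+1) ct) ?fss ?enum_uniq //.
rewrite [X in _ + X]big_pred0 => [|x]; last by rewrite mem_enum.
rewrite addn0 -(big_map size predT (fun k => k * (k == i.+1))).
rewrite -[map size ss]/(shape ss) reshapeKl ?shn // shE (bigD1 i) //= eqxx muln1.
rewrite big1 ?addn0 // => j ji; rewrite eqSS; case: eqP => [/val_inj E|_].
  by rewrite E eqxx in ji.
by rewrite !muln0.
Qed.

(* The number of 3-cycles [c] with [c * t] conjugate to [t], for any [t] of cycle
   type [f]; the subtraction and the division are exact when [f] is a partition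
   of [n]. *)
Definition type_count f : nat :=
  (\sum_(i < n) \sum_(1 <= j < (f i).+1) (i.+1 ^ 3 + 2 * i.+1) + 3 * n ^ 2
   - \sum_(i < n) \sum_(1 <= j < (f i).+1) 6 * (i.+1 * (i.+1 * j))) %/ 6.

Lemma count_cycle_type t :
  6 * #|[set c : 'S_n | is_3cycle c & preserves_type t c]|
  + \sum_(i < n) \sum_(1 <= j < (cycle_type t i).+1) 6 * (i.+1 * (i.+1 * j))
  = \sum_(i < n) \sum_(1 <= j < (cycle_type t i).+1) (i.+1 ^ 3 + 2 * i.+1) + 3 * n ^ 2.
Proof.
have := count_type_preserving_ncycles t; rewrite card_ord => H.
rewrite [X in _ + X = _](eq_bigr (fun i : 'I_n =>
  \sum_(1 <= j < (ncycles t i.+1).+1) 6 * (i.+1 * (i.+1 * j)))) ?H; last first.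
  by move=> i _; rewrite cycle_typeE.
by congr (_ + _); apply: eq_bigr => i _; rewrite cycle_typeE.
Qed.

Lemma type_countE t :
  #|[set c : 'S_n | is_3cycle c & preserves_type t c]| = type_count (cycle_type t).
Proof. by rewrite /type_count -count_cycle_type addnK mulKn. Qed.

Lemma type_count_partition f : f \in partitions_in n n ->
  6 * type_count f + \sum_(i < n) \sum_(1 <= j < (f i).+1) 6 * (i.+1 * (i.+1 * j))
  = \sum_(i < n) \sum_(1 <= j < (f i).+1) (i.+1 ^ 3 + 2 * i.+1) + 3 * n ^ 2.
Proof. by case/cycle_type_surj=> t <-; rewrite -type_countE count_cycle_type. Qed.

(** The commutator is [t^-1 * t ^ s], so [s] matters only through the conjugate [u = t ^ s]; then
    [c = t^-1 * u] runs over the 3-cycles with [t * c], equivalently its conjugate [c * t],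
    conjugate to [t]. *)
Lemma card_commutator_3cycle t :
  #|[set s : 'S_n | is_3cycle (commf s t)]| = #|'C[t]%g| * type_count (cycle_type t).
Proof.
have commJ s : commf s t = (t^-1 * t ^ s)%g by rewrite conjgE /commf -!mulgA.
transitivity #|[set s | is_3cycle (t^-1 * t ^ s)%g]|.
  by apply: eq_card => s; rewrite !inE commJ.
rewrite (card_conjg_pred t (fun u => is_3cycle (t^-1 * u)%g)); congr (_ * _).
rewrite -type_countE -(card_imset _ (mulgI t)); apply: eq_card => u.
rewrite inE; apply/andP/imsetP => [[ut cu]|[c]].
  exists (t^-1 * u)%g; last by rewrite mulKVg.
  rewrite inE cu /preserves_type (_ : (t^-1 * u * t)%g = (u ^ t)%g); last by rewrite conjgE mulgA.
  exact: class_trans (memJ_class u (in_setT t)) ut.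
rewrite inE => /andP[c3c pc] ->; rewrite mulKg c3c; split=> //.
rewrite (_ : (t * c)%g = (c * t) ^ t^-1)%g; last by rewrite conjgE invgK !mulgA mulgK.
exact: class_trans (memJ_class _ (in_setT _)) pc.
Qed.

(** The permutations of one cycle type form a class; its size times the order of a centralizer is
    [n!], whatever the type. *)
Lemma card_Bset : #|Bset n| = (\sum_(f in partitions_in n n) type_count f) * n`!.
Proof.
transitivity (\sum_t #|[set s : 'S_n | is_3cycle (commf s t)]|).
  rewrite -sum1_card (eq_bigl (fun p : 'S_n * 'S_n => is_3cycle (commf p.1 p.2))); last first.
    by move=> p; rewrite inE.
  rewrite -(pair_big_dep predT (fun s t => is_3cycle (commf s t)) (fun _ _ => 1)) /=.
  rewrite (exchange_big_dep predT) //=; apply: eq_bigr => t _.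
  by rewrite -sum1_card; apply: eq_bigl => s; rewrite inE.
rewrite (partition_big cycle_type [in partitions_in n n]) /=; last first.
  by move=> t _; exact: cycle_type_partition.
rewrite big_distrl; apply: eq_bigr => f /cycle_type_surj[t0 t0f] /=.
transitivity (\sum_(t in (t0 ^: [set: 'S_n])%g) type_count f * #|'C[t0]%g|).
  apply: eq_big => t; first by rewrite -cycle_type_eq t0f.
  move=> /eqP tf; rewrite card_commutator_3cycle tf mulnC; congr (_ * _).
  have : t \in (t0 ^: [set: 'S_n])%g by rewrite -cycle_type_eq tf t0f.
  by case/imsetP=> v _ ->; rewrite cent1J cardJg.
by rewrite sum_nat_const mulnCA [X in _ * X]mulnC card_class_cent1 card_Sn.
Qed.

(** Summing [type_count_partition] leaves [3 n^2 P(n)]. Four times that identity, with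
    [npartitions_rec2] substituted, is three times the claim, which explains the coefficient 8. *)
Lemma sum_type_count :
  8 * (\sum_(f in partitions_in n n) type_count f)
  + 6 * (\sum_(1 <= k < n.+1) k * sigma 1 k * npartitions (n - k))
  = 3 * (\sum_(1 <= k < n.+1) sigma 3 k * npartitions (n - k)) + 3 * (n * npartitions n).
Proof.
have : 6 * (\sum_(f in partitions_in n n) type_count f)
    + \sum_(f in partitions_in n n) \sum_(i < n)
        \sum_(1 <= j < (f i).+1) 6 * (i.+1 * (i.+1 * j))
    = \sum_(f in partitions_in n n) \sum_(i < n)
        \sum_(1 <= j < (f i).+1) (i.+1 ^ 3 + 2 * i.+1)
    + \sum_(f in partitions_in n n) 3 * n ^ 2.
  by rewrite big_distrr -!big_split /=; apply: eq_bigr => f; exact: type_count_partition.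
rewrite (sum_partitions n (fun p j => 6 * (p * (p * j)))).
rewrite (sum_partitions n (fun p j => p ^ 3 + 2 * p)).
rewrite sum_nat_const card_partitions_in //.
have -> : \sum_(1 <= k < n.+1) (\sum_(d <- divisors k) 6 * (d * (d * (k %/ d))))
      * npartitions (n - k)
    = 6 * (\sum_(1 <= k < n.+1) k * sigma 1 k * npartitions (n - k)).
  rewrite big_distrr; apply: eq_big_nat => k /andP[k0 _] /=; rewrite mulnA; congr (_ * _).
  rewrite /sigma !big_distrr; apply: eq_big_seq => d /=.
  by rewrite -dvdn_divisors // => dk; rewrite (mulnC d (_ %/ _)) divnK // (mulnC d).
have -> : \sum_(1 <= k < n.+1) (\sum_(d <- divisors k) (d ^ 3 + 2 * d)) * npartitions (n - k)
    = \sum_(1 <= k < n.+1) sigma 3 k * npartitions (n - k) + 2 * (n * npartitions n).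
  rewrite -npartitions_rec big_distrr -big_split; apply: eq_bigr => k _ /=.
  by rewrite mulnA -mulnDl big_split -big_distrr.
have := npartitions_rec2 n; lia.
Qed.

End CycleType.

Import GRing.Theory.
Local Open Scope ring_scope.

Theorem mainTheorem12 (n : nat) (hn : (2 < n)%N) :
  8%:R * #|Bset n|%:R
  = 3%:R * (((\sum_(1 <= k < n.+1) sigma 3 k * npartitions (n - k))%N)%:R
            - 2%:R * ((\sum_(1 <= k < n.+1) k * sigma 1 k * npartitions (n - k))%N)%:R
            + (n * npartitions n)%N%:R) * (n`!)%:R :> int.
Proof.
have := sum_type_count n; rewrite card_Bset; set C := (n * npartitions n)%N.
set A := (\sum_(1 <= k < n.+1) sigma 3 k * _)%N; set B := (\sum_(1 <= k < n.+1) k * _ * _)%N.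
move: (\sum_(f in _) _)%N A B C => K A B C H.
(* The subtraction-free identity is moved to the integers, where the [B] term can change sides. *)
have {}H : 8%:R * K%:R + 6%:R * B%:R = 3%:R * A%:R + 3%:R * C%:R :> int.
  by rewrite -!natrM -!natrD H.
rewrite natrM mulrA (_ : 8%:R * K%:R = 3%:R * A%:R + 3%:R * C%:R - 6%:R * B%:R).
  by ring.
by rewrite -H addrK.
Qed.
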